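(* Let $-1 \le a < b \le 1$, $\alpha=\arccos a$, $\beta=\arccos b$. Define $g:[0,\pi]\to\mathbb{R}$ by $g(\theta)=1$ for $\theta\in(\beta,\alpha)$, $g(\theta)=\tfrac12$ for $\theta\in\{\alpha,\beta\}$, $g(\theta)=0$ for $\theta\in[0,\pi]\setminus[\beta,\alpha]$, and let $c_0=\frac{1}{\pi}(\alpha-\beta)$, $c_j=\frac{2}{\pi}\cdot\frac{\sin(j\alpha)-\sin(j\beta)}{j}$ for $j\ge1$. For $m>0$ and integers $k\ge1$, define the exponent-$m$ Lanczos damping factors $d^m_{0,k}=1$ and \[ d^m_{j,k}=\left(\frac{\sin\left(\frac{j\pi}{k+1}\right)}{\frac{j\pi}{k+1}}\right)^m,\quad j\ge 1, \] and for an integer $k'$ with $1\le k'\le k$ define $g^m_{k',k}(\theta)=\sum_{j=0}^{k'} c_j\, d^m_{j,k}\cos(j\theta)$. Then for every $m>0$, every integer $k\ge1$, every integer $1\le k'\le k$, and every $\theta\in[0,\pi]$, \[ |g(\theta)-g^m_{k',k}(\theta)|\le \frac{d^m_{k',k}\,J(\theta)}{\pi(k'+1)}+\frac{m\,\mathcal{C}_m\,J(\theta)}{k+1}+\frac{m\pi(\pi-\theta)}{3(k+1)^2}, \] where \[ \mathcal{C}_m=\int_0^{\pi}\frac{(\sin u)^{m-1}(\sin u-u\cos u)}{u^{m+2}}\,du, \] and \[ J(\theta)=\begin{cases} \frac{1}{|\sin\frac{\theta+\alpha}{2}|}+\frac{1}{|\sin\frac{\theta-\alpha}{2}|}+\frac{1}{|\sin\frac{\theta+\beta}{2}|}+\frac{1}{|\sin\frac{\theta-\beta}{2}|},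 & \theta\ne\alpha,\beta,\\[4pt] \frac{1}{|\sin\alpha|}+\frac{1}{|\sin\frac{\alpha+\beta}{2}|}+\frac{1}{|\sin\frac{\alpha-\beta}{2}|}, & \theta=\alpha,\\[4pt] \frac{1}{|\sin\beta|}+\frac{1}{|\sin\frac{\alpha+\beta}{2}|}+\frac{1}{|\sin\frac{\alpha-\beta}{2}|}, & \theta=\beta. \end{cases} \]
   Context: Any term of the form $1/0$ in $J(\theta)$ is interpreted as $+\infty$, in which case the bound holds trivially. The function $g^m_{k',k}$ is a damped partial Fourier cosine sum of $g$, where the damping factors are computed for the maximal degree $k$ but the sum is truncated at degree $k'$. *)

(* Defs.v *)
From HB Require Import structures.
From mathcomp Require Import all_boot all_order all_algebra.
From mathcomp Require Import all_classical all_reals all_analysis.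
Set Implicit Arguments. Unset Strict Implicit. Unset Printing Implicit Defensive.
Import Order.TTheory GRing.Theory Num.Theory.
Local Open Scope ring_scope.
Local Open Scope classical_set_scope.

Section Defs.
Variable R : realType.

Definition gstep (alpha beta theta : R) : R :=
  if (beta < theta) && (theta < alpha) then 1
  else if (theta == alpha) || (theta == beta) then 1 / 2
  else 0.

Definition ccoef (alpha beta : R) (j : nat) : R :=
  if j == 0%N then (alpha - beta) / pi
  else 2 / pi * ((sin (j%:R * alpha) - sin (j%:R * beta)) / j%:R).

Definition damp (m : R) (j k : nat) : R :=
  if j == 0%N then 1
  else let x := j%:R * pi / k.+1%:R in (sin x / x) `^ m.

Definition gdamped (alpha beta m : R) (k' k : nat) (theta : R) : R :=
  \sum_(0 <= j < k'.+1) ccoef alpha beta j * damp m j k * cos (j%:R * theta).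

Definition einvabs (x : R) : \bar R :=
  if x == 0 then +oo%E else (`|x|^-1)%:E.

Definition Jfun (alpha beta theta : R) : \bar R :=
  if theta == alpha then
    (einvabs (sin alpha) + einvabs (sin ((alpha + beta) / 2))
      + einvabs (sin ((alpha - beta) / 2)))%E
  else if theta == beta then
    (einvabs (sin beta) + einvabs (sin ((alpha + beta) / 2))
      + einvabs (sin ((alpha - beta) / 2)))%E
  else
    (einvabs (sin ((theta + alpha) / 2)) + einvabs (sin ((theta - alpha) / 2))
     + einvabs (sin ((theta + beta) / 2)) + einvabs (sin ((theta - beta) / 2)))%E.

Definition Cm (m : R) : \bar R :=
  (\int[lebesgue_measure]_(u in `[0%R, (pi : R)]%classic)
     ((sin u `^ (m - 1)) * (sin u - u * cos u) / (u `^ (m + 2)))%:E)%E.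

End Defs.

(* Main.v *)
Require Import Defs.
From HB Require Import structures.
From mathcomp Require Import all_boot all_order all_algebra.
From mathcomp Require Import all_classical all_reals all_analysis.
From mathcomp Require Import measurable_realfun ring lra.
Import Order.TTheory GRing.Theory Num.Theory.
Import numFieldNormedType.Exports.
Local Open Scope ring_scope.

(* By product-to-sum formulas the undamped partial sum [S_j] of the step
   function [g] is a combination of four partial sums of the sawtooth series
   [sum sin (i x) / i], at [x = theta +- alpha, theta +- beta].  Summation by
   parts bounds each sawtooth remainder of order [j] by
   [1 / ((j + 1) |sin (x / 2)|)], so [|g - S_j| <= J / (pi (j + 1))].
   A second summation by parts writes the damped error as
   [d_k' (g - S_k') + sum_(j < k') (d_j - d_(j+1)) (g - S_j)].  With
   [f u = (sin u / u)^m] and [x_j = j pi / (k + 1)], one has [d_j = f x_j] and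
   [1 / (pi (j + 1)) = 1 / ((k + 1) x_(j+1))], so the last sum is at most
   [J / (k + 1)] times the integral of [- f' u / u], that is [m C_m J / (k + 1)].
   The term in [(k + 1)^-2] is pure slack. *)

(** * Summation by parts *)

Section Abel.
Context {R : realFieldType}.
Implicit Types (a s c d : nat -> R) (B g : R).

(** Abel's inequality: with [D] the partial sums of [s], the sum is [a N * D N] plus the sum of
    [(a j - a j.+1) * D j.+1], and these nonnegative weights add up to [a n]. *)
Lemma abel_bound a s B n N : (n <= N)%N ->
  (forall j, 0 <= a j) -> (forall j, a j.+1 <= a j) ->
  (forall k, (n <= k)%N -> `|\sum_(n <= j < k) s j| <= B) ->
  `|\sum_(n <= j < N) s j * a j| <= B * a n.
Proof.
move=> nN a0 adec sB.
pose D k := \sum_(n <= j < k) s j.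
have H : `|\sum_(n <= j < N) s j * a j - a N * D N| <= B * (a n - a N).
  rewrite -(subnKC nN); elim: (N - n)%N => [|k IH].
    by rewrite addn0 /D !big_geq// mulr0 !subrr mulr0 normr0.
  rewrite addnS /D !big_nat_recr ?leq_addr//= -/(D _).
  set M := (n + k)%N in IH *; set T := (\sum_(n <= j < M) _) in IH *.
  have -> : T + s M * a M - a M.+1 * (D M + s M) =
      (T - a M * D M) + (a M - a M.+1) * D M.+1.
    by rewrite /D big_nat_recr ?leq_addr//= -/(D _); ring.
  have -> : B * (a n - a M.+1) = B * (a n - a M) + (a M - a M.+1) * B by ring.
  rewrite (le_trans (ler_normD _ _))// lerD// normrM ger0_norm ?subr_ge0//.
  by rewrite ler_wpM2l ?subr_ge0// sB// leqW ?leq_addr.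
have -> : \sum_(n <= j < N) s j * a j =
  (\sum_(n <= j < N) s j * a j - a N * D N) + a N * D N by rewrite subrK.
have -> : B * a n = B * (a n - a N) + a N * B by ring.
rewrite (le_trans (ler_normD _ _))// lerD// normrM ger0_norm//.
by rewrite ler_wpM2l// sB.
Qed.

(** The numbers [d j - d j.+1] for [j < n], together with [d n], are nonnegative and add up to
    [d 0 = 1]: the damped sum is a weighted mean of the plain partial sums, and its error is the
    same mean of their errors. *)
Lemma damped_sum_bound c d B g n : d 0%N = 1 ->
  (forall j, (j < n)%N -> d j.+1 <= d j) -> 0 <= d n ->
  (forall j, (j <= n)%N -> `|g - \sum_(0 <= i < j.+1) c i| <= B / j.+1%:R) ->
  `|g - \sum_(0 <= j < n.+1) d j * c j| <=
    d n * (B / n.+1%:R) + (\sum_(0 <= j < n) (d j - d j.+1) / j.+1%:R) * B.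
Proof.
move=> d0 ddec dn0 gB.
pose S k := \sum_(0 <= i < k.+1) c i; pose T k := \sum_(0 <= i < k.+1) d i * c i.
(* The quantity inside the norm is the sum over [j < k] of [(d j - d j.+1) * (g - S j)]. *)
have H k : (k <= n)%N -> `|g * (1 - d k) - (T k - d k * S k)| <=
    (\sum_(0 <= j < k) (d j - d j.+1) / j.+1%:R) * B.
  elim: k => [_|k IH kn].
    by rewrite /T /S !big_nat1 big_geq// d0 mul0r subrr mulr0 subrr subrr normr0.
  have -> : g * (1 - d k.+1) - (T k.+1 - d k.+1 * S k.+1) =
     (g * (1 - d k) - (T k - d k * S k)) + (d k - d k.+1) * (g - S k).
    by rewrite /T /S !(big_nat_recr k.+1)//=; ring.
  rewrite (big_nat_recr k)//= [leRHS]mulrDl (le_trans (ler_normD _ _))// lerD ?IH 1?ltnW//.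
  rewrite normrM ger0_norm ?subr_ge0 ?ddec// -mulrA ler_wpM2l ?subr_ge0 ?ddec//.
  by rewrite mulrC gB// ltnW.
have -> : g - T n = d n * (g - S n) + (g * (1 - d n) - (T n - d n * S n)) by ring.
rewrite (le_trans (ler_normD _ _))// lerD ?H// normrM ger0_norm//.
by rewrite ler_wpM2l// gB.
Qed.

End Abel.

(** * Remainders of the sawtooth series *)

Section Sawtooth.
Context {R : realType}.
Implicit Types (x t : R) (n : nat).

Lemma MVT_is_derive (f df : R -> R) (a b : R) : a <= b ->
  (forall x, a <= x <= b -> is_derive x 1 f (df x)) ->
  exists2 c, a <= c <= b & f b - f a = df c * (b - a).
Proof.
move=> ab fdf.
have dfo x : x \in `]a, b[%R -> is_derive x 1 f (df x).
  by rewrite in_itv/= => /andP[ax xb]; apply: fdf; rewrite !ltW.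
have [|c] := @MVT_segment R f df a b ab dfo.
  apply: derivable_within_continuous => x; rewrite in_itv/= => xab.
  by apply: ex_derive; exact: fdf.
by rewrite in_itv/= => cab E; exists c.
Qed.

Lemma is_derive_sinMl (c t : R) :
  is_derive t 1 (fun y => sin (c * y)) (c * cos (c * t)).
Proof.
have -> : (fun y : R => sin (c * y)) = sin \o ( *%R c) by [].
by apply: is_derive_eq; rewrite /GRing.scale/=; ring.
Qed.

Lemma is_derive_cosMl (c t : R) :
  is_derive t 1 (fun y => cos (c * y)) (- (c * sin (c * t))).
Proof.
have -> : (fun y : R => cos (c * y)) = cos \o ( *%R c) by [].
by apply: is_derive_eq; rewrite /GRing.scale/=; ring.
Qed.

Definition sinser n x := \sum_(0 <= j < n) sin (j.+1%:R * x) / j.+1%:R.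

(** On []0, 2 pi[] the series sums to [(pi - x) / 2], so this is its remainder after [n] terms. *)
Definition sawrem n x := (pi - x) / 2 - sinser n x.

Lemma is_derive_sawrem n x :
  is_derive x 1 (sawrem n) (- (1 / 2 + \sum_(0 <= j < n) cos (j.+1%:R * x))).
Proof.
elim: n => [|n IH].
  have -> : sawrem 0 = (fun y => 2^-1 *: (pi - y)).
    by apply/funext => y; rewrite /sawrem /sinser big_geq// subr0 mulrC.
  apply: is_derive_eq; rewrite big_geq// /GRing.scale/=.
  by field.
have -> : sawrem n.+1 =
    sawrem n - (fun y => (n.+1%:R)^-1 *: sin (n.+1%:R * y)).
  apply/funext => y; rewrite /sawrem /sinser big_nat_recr//=.
  by rewrite fctE opprD addrA; congr (_ - _); exact: mulrC.
have H := is_derive_sinMl n.+1%:R x.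
apply: is_derive_eq.
rewrite big_nat_recr//= addrA [RHS]opprD; congr (_ - _).
by apply: mulKf; rewrite pnatr_eq0.
Qed.

(** Closed form of the Dirichlet kernel: multiplied by [sin (x / 2)], each cosine becomes half a
    difference of sines at consecutive half-integer multiples of [x], and the sum telescopes. *)
Lemma sin_mul_cos_sum n x :
  sin (x / 2) * (1 / 2 + \sum_(0 <= j < n) cos (j.+1%:R * x)) =
  sin ((n%:R + 1 / 2) * x) / 2.
Proof.
elim: n => [|n IH]; first by rewrite big_geq// addr0 add0r mul1r [2^-1 * x]mulrC mulrC.
rewrite big_nat_recr//= addrA mulrDr IH.
have -> : (n%:R + 1 / 2) * x = n.+1%:R * x - x / 2.
  by rewrite -[n.+1%:R]natr1; field.
have -> : (n.+1%:R + 1 / 2) * x = n.+1%:R * x + x / 2 by field.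
by rewrite sinB sinD; field.
Qed.

Lemma sin_mul_sin_sum m n x : (m <= n)%N ->
  sin (x / 2) * \sum_(m <= j < n) sin (j.+1%:R * x) =
  (cos ((m%:R + 1 / 2) * x) - cos ((n%:R + 1 / 2) * x)) / 2.
Proof.
move=> /subnKC <-; elim: (n - m)%N => [|k IH].
  by rewrite addn0 big_geq// mulr0 subrr mul0r.
rewrite addnS big_nat_recr ?leq_addr//= mulrDr IH; set p := (m + k)%N.
have -> : (p%:R + 1 / 2) * x = p.+1%:R * x - x / 2.
  by rewrite -[p.+1%:R]natr1; field.
have -> : (p.+1%:R + 1 / 2) * x = p.+1%:R * x + x / 2 by field.
by rewrite cosB cosD; field.
Qed.

(** Abel's inequality with weights [1 / (j + 1)]: the closed form bounds the sums of sines by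
    [1 / sin (x / 2)], whatever their length. *)
Lemma sinser_tail n N x : (n <= N)%N -> 0 < sin (x / 2) ->
  `|sinser N x - sinser n x| <= (sin (x / 2))^-1 * (n.+1%:R)^-1.
Proof.
move=> nN s0; rewrite /sinser (big_cat_nat (n := n))//= [X in `|X|]addrC addKr.
apply: (@abel_bound _ (fun j => (j.+1%:R)^-1) (fun j => sin (j.+1%:R * x))) => //.
  by move=> j; rewrite lef_pV2 ?posrE// ler_nat.
move=> k nk; rewrite -(ler_pM2l s0) divff ?gt_eqF//.
rewrite -{1}[sin (x / 2)]gtr0_norm// -normrM sin_mul_sin_sum// normrM.
rewrite [`|2^-1|]ger0_norm// ler_pdivrMr// [1 * 2]mul1r (le_trans (ler_normB _ _))//.
by rewrite -[leRHS]/(1 + 1) lerD// cos_max.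
Qed.

Lemma sin_half_ge x t : 0 < x -> x <= t -> t <= pi -> sin (x / 2) <= sin (t / 2).
Proof.
move=> x0 xt tpi; have p0 := pi_gt0 R.
move: xt; rewrite le_eqVlt => /predU1P[->//|xt].
by apply: ltW; rewrite ltr_sin ?in_itv/=; lra.
Qed.

Lemma sin_natMpi n : sin (n%:R * pi) = 0 :> R.
Proof.
have := alternatingn (@sinDpi R) n 0.
by rewrite add0r sin0 mulr0 mulr_natl.
Qed.

(* The subtracted term is the boundary term of an integration by parts of
   [int_x^pi sin ((N+1/2) t) / (2 sin (t/2)) dt]. *)
Lemma sawrem_decay N x : 0 < x -> x <= pi ->
  `|sawrem N x| <= (pi + 1) / sin (x / 2) ^+ 2 / (N.*2.+1)%:R.
Proof.
move=> x0 xpi; have p0 := pi_gt0 R.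
have s0 : 0 < sin (x / 2) by apply: sin_gt0_pi; lra.
pose M : R := (N.*2.+1)%:R.
have M0 : 0 < M by rewrite ltr0n.
have ME : N%:R + 1 / 2 = M / 2 :> R.
  by rewrite /M -[(N.*2.+1)%:R]natr1 -mul2n natrM; field.
pose q t := cos ((M / 2) * t) * (sin (2^-1 * t))^-1.
(* Subtracting [q / M] cancels the Dirichlet kernel in the derivative; what remains, [dh], carries a
   factor [1 / M]. *)
pose h := sawrem N - M^-1 *: q.
pose dh t := cos (M / 2 * t) * cos (2^-1 * t) / (2 * M * sin (2^-1 * t) ^+ 2).
have sE t : t / 2 = 2^-1 * t by rewrite mulrC.
have st t : x <= t <= pi -> sin (x / 2) <= sin (2^-1 * t).
  by rewrite -sE => /andP[xt tp]; exact: sin_half_ge.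
have dhP t : x <= t <= pi -> is_derive t 1 h (dh t).
  move=> /st xt; have t0 := lt_le_trans s0 xt.
  have H1 := is_derive_sawrem N t.
  have H2 := is_derive_cosMl (M / 2) t.
  have H3 := is_derive_sinMl 2^-1 t.
  have H4 := is_deriveV (lt0r_neq0 t0) H3.
  have E := sin_mul_cos_sum N t; rewrite ME sE in E.
  apply: is_derive_eq; rewrite /dh.
  rewrite -[- (1 / 2 + _)](mulKf (lt0r_neq0 t0)) mulrN E.
  rewrite /GRing.scale/=; field.
  by rewrite !gt_eqF.
have [c /st cx] := MVT_is_derive _ _ _ _ xpi dhP.
have c0 := lt_le_trans s0 cx.
have hE t : h t = sawrem N t - M^-1 * q t by [].
(* Both parts vanish at [pi], as [sin (j pi) = 0] and [cos ((N + 1/2) pi) = 0], so the mean value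
   theorem on [[x, pi]] bounds [h x] itself. *)
have hpi : h pi = 0.
  rewrite hE /q.
  have -> : M / 2 * pi = N%:R * pi + pi / 2 by rewrite -ME; field.
  rewrite cosDpihalf sin_natMpi oppr0 mul0r mulr0 subr0.
  rewrite /sawrem subrr mul0r sub0r /sinser big1 ?oppr0// => j _.
  by rewrite sin_natMpi mul0r.
rewrite hpi sub0r => hx'.
have -> : sawrem N x = h x + M^-1 * q x.
  by rewrite hE addrNK.
have s1 : sin (x / 2) <= 1 := sin_le1 _.
have M1 : 0 < M^-1 by rewrite invr_gt0.
have hx : `|h x| <= pi / sin (x / 2) ^+ 2 / M.
  rewrite -normrN hx' normrM (@ger0_norm _ (pi - x)) ?subr_ge0//.
  rewrite /dh normrM normfV [X in `|_| / X]ger0_norm; last first.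
    by rewrite !mulr_ge0 ?exprn_ge0// ltW.
  set s := sin (x / 2) in s0 cx *; set w := sin (2^-1 * c) in c0 cx *.
  have -> : pi / s ^+ 2 / M = (1 * 1) / (s ^+ 2 * M) * pi.
    by field; rewrite !gt_eqF.
  apply: ler_pM => //.
  - by rewrite mulr_ge0// invr_ge0 !mulr_ge0 ?exprn_ge0// ltW.
  - by rewrite subr_ge0.
  - apply: ler_pM => //; first by rewrite invr_ge0 !mulr_ge0 ?exprn_ge0// ltW.
      by rewrite normrM ler_pM// cos_max.
    rewrite lef_pV2 ?posrE ?mulr_gt0 ?exprn_gt0//.
    rewrite [s ^+ 2 * M]mulrC [2 * M]mulrC -mulrA ler_pM2l//.
    have : s ^+ 2 <= w ^+ 2 by rewrite lerXn2r// nnegrE ltW.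
    by have := exprn_gt0 2 c0; lra.
  - by rewrite gerBl ltW.
have qx : `|M^-1 * q x| <= 1 / sin (x / 2) ^+ 2 / M.
  rewrite /q normrM gtr0_norm// mulrC ler_pM2r// normrM ler_pM//; first exact: cos_max.
  rewrite [2^-1 * x]mulrC gtr0_norm ?invr_gt0//.
  by rewrite lef_pV2 ?posrE ?exprn_gt0// expr2 ler_piMr// ltW.
rewrite (le_trans (ler_normD _ _))// (le_trans (lerD hx qx))//.
by rewrite -!mulrDl.
Qed.
End Sawtooth.

(** * Fourier partial sums of the step function *)

Section Step.
Context {R : realType}.
Implicit Types (x theta alpha beta : R) (n : nat).

(** The remainder is a finite tail from [n] to [N], bounded uniformly in [N], plus the remainder of
    order [N], which tends to 0. *)
Lemma sawrem_bound n x : 0 < x -> x < 2 * pi ->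
  `|sawrem n x| <= (sin (x / 2))^-1 * (n.+1%:R)^-1.
Proof.
have p0 := pi_gt0 R.
(* The reflection of [x] to [2 pi - x] changes the sign of the remainder and preserves
   [sin (x / 2)]. *)
wlog xpi : x / x <= pi.
  move=> H x0 x2; have [xpi|pix] := leP x pi; first exact: H.
  have E : sinser n (2 * pi - x) = - sinser n x.
    rewrite /sinser -sumrN; apply: eq_bigr => j _; rewrite -mulNr -sinN.
    rewrite -[in RHS](periodicn (@sinD2pi R) j.+1); congr (sin _ / _).
    by rewrite -[pi *+ 2 *+ _]mulr_natl -[pi *+ 2]mulr_natl; ring.
  have -> : sawrem n x = - sawrem n (2 * pi - x) by rewrite /sawrem E; field.
  have -> : sin (x / 2) = sin ((2 * pi - x) / 2).
    have -> : (2 * pi - x) / 2 = - (x / 2) + pi by field.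
    by rewrite sinDpi sinN opprK.
  by rewrite normrN; apply: H; lra.
move=> x0 x2.
have s0 : 0 < sin (x / 2) by apply: sin_gt0_pi; lra.
apply/ler_addgt0Pr => e e0.
pose C := (pi + 1) / sin (x / 2) ^+ 2.
have C0 : 0 <= C by apply: divr_ge0; [lra | exact/exprn_ge0/ltW].
(* Then [C / e <= N <= 2 N + 1], which makes the decay bound at most [e]. *)
pose N := maxn n (Num.bound (C / e)).
have -> : sawrem n x = (sinser N x - sinser n x) + sawrem N x.
  by rewrite /sawrem; ring.
rewrite (le_trans (ler_normD _ _))// lerD ?sinser_tail ?leq_maxl//.
rewrite (le_trans (sawrem_decay N x x0 xpi))// ler_pdivrMr// -ler_pdivrMl//.
have /archi_boundP/ltW Ce : 0 <= C / e by apply: divr_ge0 => //; exact: ltW.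
rewrite mulrC (le_trans Ce)//.
by rewrite ler_nat (leq_trans (leq_maxr n _))// -/N -addnn -addnS leq_addr.
Qed.

(** The sum of the sine series on []-2 pi, 2 pi[], with the midpoint value 0 at its jump. *)
Definition saw x : R :=
  if x == 0 then 0 else if 0 < x then (pi - x) / 2 else - ((pi + x) / 2).

Lemma sinserN n x : sinser n (- x) = - sinser n x.
Proof.
by rewrite /sinser -sumrN; apply: eq_bigr => j _; rewrite mulrN sinN mulNr.
Qed.

Lemma saw_bound n x : `|x| < 2 * pi ->
  `|saw x - sinser n x| <= `|sin (x / 2)|^-1 * (n.+1%:R)^-1.
Proof.
have H y : 0 < y -> y < 2 * pi ->
    `|saw y - sinser n y| <= `|sin (y / 2)|^-1 * (n.+1%:R)^-1.
  move=> y0 y2; rewrite /saw gt_eqF// y0 [`|sin _|]ger0_norm; first exact: sawrem_bound.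
  by apply: sin_ge0_pi; lra.
have [x0|x0|->] := ltgtP x 0; last first.
(* At 0 both sides are 0, because [0^-1 = 0]. *)
- move=> _; rewrite /saw eqxx mul0r sin0 normr0 invr0 mul0r.
  by rewrite /sinser big1 ?subrr ?normr0// => j _; rewrite mulr0 sin0 mul0r.
- by rewrite [`|x|]gtr0_norm//; exact: H.
rewrite ltr0_norm// => x2; have := H (- x); rewrite oppr_gt0 => /(_ x0 x2).
rewrite mulNr sinN normrN; suff -> : saw (- x) = - saw x.
  by rewrite sinserN -opprD normrN.
rewrite /saw oppr_eq0 lt_eqF// oppr_gt0 x0 ltNge ltW//=.
by field.
Qed.

(** The linear pieces cancel, and the jump of height [pi] of [saw] at 0 produces the jumps at
    [alpha] and [beta]; its midpoint value gives [1 / 2] there. The last two hypotheses keep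
    [theta + alpha] and [theta + beta] inside []0, 2 pi[]. *)
Lemma gstep_saw alpha beta theta : 0 <= beta -> beta < alpha -> alpha <= pi ->
  0 <= theta -> theta <= pi -> theta + alpha < 2 * pi -> 0 < theta + beta ->
  gstep alpha beta theta = (alpha - beta) / pi +
    (saw (theta + alpha) - saw (theta - alpha)
     - saw (theta + beta) + saw (theta - beta)) / pi.
Proof.
move=> b0 ba api t0 tpi ta tb; have p0 := pi_gt0 R.
rewrite /gstep /saw !subr_eq0 !subr_gt0 (gt_eqF tb) tb.
have -> : theta + alpha == 0 = false by apply/eqP; lra.
have -> : 0 < theta + alpha by lra.
move: (@pi R) p0 api tpi ta => p p0 api tpi ta.
case: (ltgtP beta theta) => h1; case: (ltgtP theta alpha) => h2 /=;
  try lra; subst; try lra; field; exact: lt0r_neq0.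
Qed.

(** Product-to-sum: [2 sin (j alpha) cos (j theta)] is [sin (j (theta + alpha)) - sin (j (theta -
    alpha))]. *)
Lemma ccoef_cos_sum alpha beta theta n :
  \sum_(0 <= j < n.+1) ccoef alpha beta j * cos (j%:R * theta) =
  (alpha - beta) / pi + (sinser n (theta + alpha) - sinser n (theta - alpha)
    - sinser n (theta + beta) + sinser n (theta - beta)) / pi.
Proof.
have p0 : (pi : R) != 0 by rewrite gt_eqF// pi_gt0.
rewrite big_nat_recl// mul0r cos0 mulr1; congr (_ + _).
rewrite /sinser -!sumrB -big_split/= mulr_suml; apply: eq_bigr => j _.
rewrite /ccoef /= !mulrDr !mulrN !sinD !sinN !cosN.
have j0 : j.+1%:R != 0 :> R by rewrite pnatr_eq0.
move: (@pi R) p0 (j.+1%:R : R) j0 => p p0 q q0; field.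
by rewrite p0 q0.
Qed.

(* At [theta = alpha] or [theta = beta] the vanishing sine contributes
   [0^-1 = 0], which gives the three-term case of [Jfun]. *)
Definition Jreal alpha beta theta : R :=
  `|sin ((theta + alpha) / 2)|^-1 + `|sin ((theta - alpha) / 2)|^-1
  + `|sin ((theta + beta) / 2)|^-1 + `|sin ((theta - beta) / 2)|^-1.

Lemma gstep_fourier_bound alpha beta theta n :
  0 <= beta -> beta < alpha -> alpha <= pi ->
  0 <= theta -> theta <= pi -> theta + alpha < 2 * pi -> 0 < theta + beta ->
  `|gstep alpha beta theta -
      \sum_(0 <= j < n.+1) ccoef alpha beta j * cos (j%:R * theta)|
    <= Jreal alpha beta theta / pi / n.+1%:R.
Proof.
move=> b0 ba api t0 tpi ta tb; have p0 := pi_gt0 R.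
rewrite gstep_saw// ccoef_cos_sum opprD addrACA subrr add0r -mulrBl normrM.
have pV0 : 0 < pi^-1 :> R by rewrite invr_gt0.
rewrite [`|pi^-1|]gtr0_norm// [leRHS]mulrAC ler_pM2r//.
have H x : `|x| < 2 * pi -> `|saw x - sinser n x| <= _ := saw_bound n x.
have /H h1 : `|theta + alpha| < 2 * pi by rewrite ger0_norm//; lra.
have /H h2 : `|theta - alpha| < 2 * pi by rewrite ltr_norml; lra.
have /H h3 : `|theta + beta| < 2 * pi by rewrite ger0_norm//; lra.
have /H h4 : `|theta - beta| < 2 * pi by rewrite ltr_norml; lra.
rewrite (_ : _ - _ = (saw (theta + alpha) - sinser n (theta + alpha))
    - (saw (theta - alpha) - sinser n (theta - alpha))
    - (saw (theta + beta) - sinser n (theta + beta))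
    + (saw (theta - beta) - sinser n (theta - beta))); last by ring.
rewrite /Jreal [leRHS]mulrDl (le_trans (ler_normD _ _))// lerD//.
rewrite [leRHS]mulrDl (le_trans (ler_normB _ _))// lerD//.
by rewrite [leRHS]mulrDl (le_trans (ler_normB _ _))// lerD.
Qed.

(** Either a sine in [Jfun] vanishes and the value is infinite, or the nonzero sines exclude
    [theta + alpha = 2 pi] and [theta + beta = 0], as the sawtooth formula requires. *)
Lemma Jfun_Jreal alpha beta theta :
  0 <= beta -> beta < alpha -> alpha <= pi -> 0 <= theta -> theta <= pi ->
  Jfun alpha beta theta = +oo%E \/
  [/\ Jfun alpha beta theta = (Jreal alpha beta theta)%:E,
      theta + alpha < 2 * pi & 0 < theta + beta].
Proof.
move=> b0 ba api t0 tpi; have p0 := pi_gt0 R.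
have oo (y : R) : 0 <= y -> y <= 2 * pi -> sin (y / 2) != 0 -> 0 < y < 2 * pi.
  move=> y0 y2 s0; apply/andP; split; rewrite lt_neqAle ?y0 ?y2 andbT.
    by apply: contra_neq s0 => <-; rewrite mul0r sin0.
  by apply: contra_neq s0 => ->; rewrite mulrAC divff// mul1r sinpi.
have dup (y : R) : (y + y) / 2 = y by field.
rewrite /Jfun /Jreal /einvabs.
have [->|ta] := eqVneq theta alpha.
  have [_|s1] := eqVneq (sin alpha) 0; first by left; do 2 case: ifP.
  have [_|s2] := eqVneq (sin ((alpha + beta) / 2)) 0; first by left; case: ifP.
  have [_|s3] := eqVneq (sin ((alpha - beta) / 2)) 0; first by left.
  right; rewrite dup subrr mul0r sin0 normr0 invr0 addr0; split => //; last lra.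
  have /oo : 0 <= alpha + alpha by lra.
  by rewrite dup s1 => /(_ _ isT)/andP[]//; lra.
have [->|tb] := eqVneq theta beta.
  have [_|s1] := eqVneq (sin beta) 0; first by left; do 2 case: ifP.
  have [_|s2] := eqVneq (sin ((alpha + beta) / 2)) 0; first by left; case: ifP.
  have [_|s3] := eqVneq (sin ((alpha - beta) / 2)) 0; first by left.
  right; rewrite dup subrr mul0r sin0 normr0 invr0 addr0; split.
  - rewrite -opprB mulNr sinN normrN [beta + alpha]addrC -!EFinD.
    by congr (_%:E); ring.
  - lra.
  have /oo : 0 <= beta + beta by lra.
  by rewrite dup s1 => /(_ _ isT)/andP[]//; lra.
have [_|s1] := eqVneq (sin ((theta + alpha) / 2)) 0; first by left; do 3 case: ifP.
have [_|s2] := eqVneq (sin ((theta - alpha) / 2)) 0; first by left; do 2 case: ifP.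
have [_|s3] := eqVneq (sin ((theta + beta) / 2)) 0; first by left; case: ifP.
have [_|s4] := eqVneq (sin ((theta - beta) / 2)) 0; first by left.
right; split => //.
  have /oo : 0 <= theta + alpha by lra.
  by rewrite s1 => /(_ _ isT)/andP[]//; lra.
have /oo : 0 <= theta + beta by lra.
by rewrite s3 => /(_ _ isT)/andP[]//; lra.
Qed.

End Step.

(** * The damping profile and the integrand of [Cm] *)

Section Damping.
Context {R : realType}.
Implicit Types (m u p q : R).

(** At [u = 0] and [m <> 0] the conventions on division and powers give 0, not the limit 1. *)
Definition sincpow m u : R := (sin u / u) `^ m.

(** On []0, pi[], [m * Cm_fun m u] is [- f' u / u] for [f = sincpow m]. *)
Definition Cm_fun m u : R :=
  (sin u `^ (m - 1)) * (sin u - u * cos u) / (u `^ (m + 2)).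

(** The difference vanishes at 0 and has derivative [u sin u >= 0]. This gives the sign of
    [Cm_fun]. *)
Lemma mul_cos_le_sin u : 0 <= u -> u <= pi -> u * cos u <= sin u.
Proof.
move=> u0 upi.
have dP t : 0 <= t <= u -> is_derive t 1 (fun y => sin y - y * cos y) (t * sin t).
  move=> _; have -> : (fun y : R => sin y - y * cos y) = sin - id * cos by [].
  by apply: is_derive_eq; rewrite /GRing.scale/=; ring.
have [c /andP[c0 cu]] := MVT_is_derive _ _ _ _ u0 dP.
rewrite sin0 mul0r !subr0 => E.
rewrite -subr_ge0 E mulr_ge0// mulr_ge0// sin_ge0_pi// c0.
exact: le_trans cu upi.
Qed.

Lemma sin_le_id u : 0 < u -> sin u <= u.
Proof.
move=> u0.
have dP t : 0 <= t <= u -> is_derive t 1 (@sin R) (cos t).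
  by move=> _; exact: is_derive_sin.
have [c /andP[c0 cu]] := MVT_is_derive _ _ _ _ (ltW u0) dP.
by rewrite sin0 !subr0 => ->; rewrite ler_piMl ?cos_le1// ltW.
Qed.

Lemma Cm_fun_ge0 m u : 0 <= u -> u <= pi -> 0 <= Cm_fun m u.
Proof.
move=> u0 upi; rewrite /Cm_fun divr_ge0 ?powR_ge0// mulr_ge0 ?powR_ge0//.
by rewrite subr_ge0 mul_cos_le_sin.
Qed.

Lemma is_derive_sincpow m u : 0 < u -> u < pi ->
  is_derive u 1 (sincpow m) (- (m * u * Cm_fun m u)).
Proof.
move=> u0 upi; have s0 : 0 < sin u by rewrite sin_gt0_pi// u0.
have H1 := is_deriveV (lt0r_neq0 u0) (is_derive_id u 1).
have -> : sincpow m = (fun x : R => x `^ m) \o (@sin R * (fun y : R => y^-1)) by [].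
have q0 : 0 < (@sin R * (fun y : R => y^-1)) u by rewrite divr_gt0.
have H2 := is_derive1_powR m q0.
apply: is_derive_eq.
rewrite /GRing.scale/= /Cm_fun.
have -> : (@sin R * (fun y : R => y^-1)) u = sin u * u^-1 by [].
have -> : (sin u * u^-1) `^ (m - 1) = sin u `^ (m - 1) / u `^ (m - 1).
  rewrite powRM ?invr_ge0 ?(ltW s0) ?(ltW u0)//; congr (_ * _).
  by rewrite -powR_inv1 ?ltW// -powRrM mulN1r powRN.
have -> : u `^ (m + 2) = u `^ (m - 1) * u ^+ 3.
  rewrite -(powR_mulrn 3 (ltW u0)) -powRD; first by congr (_ `^ _); ring.
  by rewrite (gt_eqF u0) implybT.
field.
by rewrite !lt0r_neq0// powR_gt0.
Qed.

Lemma Cm_fun_continuous m u : 0 < u -> u < pi -> {for u, continuous (Cm_fun m)}.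
Proof.
move=> u0 upi; have s0 : 0 < sin u by rewrite sin_gt0_pi// u0.
have powc (x r : R) : 0 < x -> {for x, continuous (fun y : R => y `^ r)}.
  move=> x0; apply/differentiable_continuous/derivable1_diffP.
  by apply: ex_derive; exact: is_derive1_powR.
apply: continuousM; last first.
  apply: continuousV; last exact: powc.
  by rewrite powR_eq0 gt_eqF.
apply: continuousM.
  apply: (@continuous_comp _ _ _ (@sin R) (fun y : R => y `^ (m - 1))).
    exact: continuous_sin.
  exact: powc.
apply: continuousB; first exact: continuous_sin.
by apply: continuousM; [exact: id|exact: continuous_cos].
Qed.

(** Continuity is used on the open interval alone; the two endpoints do not affect measurability. *)
Lemma measurable_Cm_fun m : measurable_fun `[0, pi]%classic (Cm_fun m).
Proof.
apply: (@measurable_fun_itv_cc R 0 pi false true).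
apply: open_continuous_measurable_fun; first exact: interval_open.
by move=> u; rewrite inE/= in_itv/= => /andP[u0 upi]; exact: Cm_fun_continuous.
Qed.

Lemma sincpow_le m p q : 0 <= m -> 0 < p -> p <= q -> q < pi ->
  sincpow m q <= sincpow m p.
Proof.
move=> m0 p0 pq qpi.
have dP t : p <= t <= q -> is_derive t 1 (sincpow m) (- (m * t * Cm_fun m t)).
  move=> /andP[pt tq]; apply: is_derive_sincpow; first exact: lt_le_trans pt.
  exact: le_lt_trans qpi.
have [c /andP[pc cq] E] := MVT_is_derive _ _ _ _ pq dP.
have c0 := le_trans (ltW p0) pc.
have C0 := Cm_fun_ge0 m c c0 (le_trans cq (ltW qpi)).
have mcC : 0 <= m * c * Cm_fun m c by apply: mulr_ge0 => //; exact: mulr_ge0.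
by rewrite -subr_le0 E mulNr oppr_le0 mulr_ge0// subr_ge0.
Qed.

Lemma measurable_mCm_fun m (D : set R) : measurable D -> (D `<=` `[0, pi])%classic ->
  measurable_fun D (fun u => (m * Cm_fun m u)%:E).
Proof.
move=> mD Dpi; apply/measurable_EFinP; apply: measurable_funM => //.
exact: measurable_funS (measurable_Cm_fun m).
Qed.

(** The difference is the integral of [m * u * Cm_fun m u], and dividing by the right endpoint
    leaves a factor [u / q <= 1]. *)
Lemma sincpow_diff_le m p q : 0 <= m -> 0 < p -> p < q -> q < pi ->
  (((sincpow m p - sincpow m q) / q)%:E <=
   \int[lebesgue_measure]_(u in `[p, q]%classic) (m * Cm_fun m u)%:E)%E.
Proof.
move=> m0 p0 pq qpi; have q0 := lt_trans p0 pq.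
have inpi u : p <= u <= q -> 0 < u /\ u < pi.
  move=> /andP[pu uq]; split; first exact: lt_le_trans pu.
  exact: le_lt_trans qpi.
have sub : (`[p, q] `<=` `[0, pi])%classic.
  move=> u /=; rewrite !in_itv/= => /inpi[u0 upi].
  by rewrite !ltW.
pose f u := m * u * Cm_fun m u.
have cf u : 0 < u -> u < pi -> {for u, continuous f}.
  move=> u0 upi; apply: continuousM; last exact: Cm_fun_continuous.
  by apply: continuousM; [exact: cst_continuous|exact: id].
have cF u : 0 < u -> u < pi -> is_derive u 1 (fun v => - sincpow m v) (f u).
  move=> u0 upi; have H := is_derive_sincpow m u u0 upi.
  by apply: is_derive_eq; rewrite opprK.
have contF u : 0 < u -> u < pi -> {for u, continuous (fun v => - sincpow m v)}.
  move=> u0 upi; apply/differentiable_continuous/derivable1_diffP.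
  by apply: ex_derive; exact: cF.
have FTC : (\int[lebesgue_measure]_(u in `[p, q]%classic) (f u)%:E =
    (- sincpow m q)%:E - (- sincpow m p)%:E)%E.
  apply: (@continuous_FTC2 R f (fun v => - sincpow m v) p q pq).
  - apply: continuous_in_subspaceT => u; rewrite inE/= in_itv/= => /inpi[u0 upi].
    exact: cf.
  - split.
    + move=> u; rewrite in_itv/= => /andP[pu uq].
      by apply: ex_derive; apply: cF; [exact: lt_trans pu|exact: lt_trans qpi].
    + by apply: cvg_at_right_filter; apply: contF => //; exact: lt_trans qpi.
    + by apply: cvg_at_left_filter; apply: contF.
  - move=> u; rewrite in_itv/= => /andP[pu uq]; rewrite derive1E.
    by apply: derive_val; apply: cF; [exact: lt_trans pu|exact: lt_trans qpi].
have f0 u : (`[p, q]%classic : set R) u -> 0 <= f u.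
  move=> /=; rewrite in_itv/= => /inpi[u0 upi].
  have C0 := Cm_fun_ge0 m u (ltW u0) (ltW upi).
  by apply: mulr_ge0 => //; apply: mulr_ge0 => //; exact: ltW.
have mf : measurable_fun (`[p, q]%classic : set R) (fun u => (f u)%:E).
  apply/measurable_EFinP; apply: measurable_funM.
    by apply: measurable_funM.
  by apply: measurable_funS sub (measurable_Cm_fun m).
have -> : (((sincpow m p - sincpow m q) / q)%:E =
    \int[lebesgue_measure]_(u in `[p, q]%classic) ((q^-1)%:E * (f u)%:E))%E.
  rewrite ge0_integralZl_EFin//.
  - by rewrite FTC -EFinB opprK -EFinM; congr (_%:E); ring.
  - by rewrite invr_ge0 ltW.
apply: ge0_le_integral => //=.
- by move=> u upq; rewrite -EFinM lee_fin mulr_ge0 ?invr_ge0 ?f0// ltW.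
- by apply: measurable_funeM.
- exact: measurable_mCm_fun.
move=> u; rewrite in_itv/= => /[dup] /inpi[u0 upi] /andP[pu uq].
rewrite -EFinM lee_fin /f -mulrA mulrCA ler_wpM2l// mulrA ler_piMl//.
  by rewrite Cm_fun_ge0// ltW.
by rewrite mulrC ler_pdivrMr// mul1r.
Qed.

End Damping.

(** * Comparison of the damping sum with the integral *)

Section DampingSum.
Context {R : realType}.
Implicit Types (m u p q : R).

Local Notation mu := (@lebesgue_measure R).

(** The one-interval estimates add up over adjacent intervals. The nodes are arbitrary so that the
    first can be a small positive number instead of 0. *)
Lemma sincpow_sum_le m (y : nat -> R) n : 0 <= m -> 0 < y 0%N -> y n < pi ->
  (forall j, (j < n)%N -> y j < y j.+1) ->
  ((\sum_(0 <= j < n) (sincpow m (y j) - sincpow m (y j.+1)) / y j.+1)%:E <=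
   \int[mu]_(u in `[y 0%N, y n]%classic) (m * Cm_fun m u)%:E)%E.
Proof.
move=> m0 y0 + incr.
have y_ge i : (i <= n)%N -> y 0%N <= y i.
  elim: i => // i IH ni; exact: le_trans (IH (ltnW ni)) (ltW (incr i ni)).
elim: n incr y_ge => [_ _ _|n IH incr y_ge ypi].
  by rewrite big_geq// set_itv1 integral_set1.
have yn := incr n (ltnSn n).
have yn0 : 0 < y n by apply: lt_le_trans y0 (y_ge n (leqnSn n)).
have yy : y 0%N <= y n := y_ge n (leqnSn n).
have {}IH := IH (fun j jn => incr j (ltnW jn)) (fun i ni => y_ge i (leqW ni))
  (lt_trans yn ypi).
have S := sincpow_diff_le m _ _ m0 yn0 yn ypi.
have sub : (`[y 0%N, y n.+1] `<=` `[0, pi])%classic.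
  move=> u /=; rewrite !in_itv/= => /andP[y0u uy].
  by rewrite (le_trans (ltW y0) y0u) (le_trans uy (ltW ypi)).
rewrite big_nat_recr//= EFinD.
have U : (`[y 0%N, y n.+1] = `[y 0%N, y n] `|` `]y n, y n.+1])%classic.
  by apply: itv_bndbnd_setU; rewrite bnd_simp// ltW.
rewrite U ge0_integral_setU//.
- apply: leeD => //; rewrite integral_itv_obnd_cbnd//.
  apply: measurable_mCm_fun => //; apply: subset_trans sub => u /=.
  by rewrite !in_itv/= => /andP[a ->]; rewrite (le_trans yy (ltW a)).
- by rewrite -U; exact: measurable_mCm_fun.
- rewrite -U => u /sub /=.
  by rewrite in_itv/= => /andP[u0 upi]; rewrite lee_fin mulr_ge0// Cm_fun_ge0.
- apply/disj_setPS => u [] /=; rewrite !in_itv/= => /andP[_ a] /andP[b _].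
  by have := lt_le_trans b a; rewrite ltxx.
Qed.

Lemma damp_sincpow m j k : damp m j.+1 k = sincpow m (j.+1%:R * pi / k.+1%:R).
Proof. by []. Qed.

Lemma node_lt_pi j k : (j <= k)%N -> j%:R * pi / k.+1%:R < pi :> R.
Proof.
move=> jk; rewrite ltr_pdivrMr// [ltRHS]mulrC ltr_pM2r ?pi_gt0// ltr_nat ltnS.
exact: jk.
Qed.

Lemma node_lt i j k : (i < j)%N -> i%:R * pi / k.+1%:R < j%:R * pi / k.+1%:R :> R.
Proof. by move=> ij; rewrite ltr_pM2r ?invr_gt0// ltr_pM2r ?pi_gt0// ltr_nat. Qed.

Lemma node_gt0 j k : 0 < j.+1%:R * pi / k.+1%:R :> R.
Proof. by rewrite divr_gt0// mulr_gt0// pi_gt0. Qed.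

Lemma damp_gt0 m j k : (j <= k)%N -> 0 < damp m j k.
Proof.
case: j => [|j] jk; rewrite ?ltr01// damp_sincpow powR_gt0// divr_gt0 ?node_gt0//.
by rewrite sin_gt0_pi// node_gt0 node_lt_pi.
Qed.

Lemma damp_decr m j k : 0 <= m -> (j < k)%N -> damp m j.+1 k <= damp m j k.
Proof.
move=> m0; case: j => [|j] jk.
  (* The factor of index 0 is 1 by definition, so the first step compares [sin x / x] with 1. *)
  rewrite damp_sincpow /sincpow [leRHS](_ : _ = 1 `^ m); last by rewrite powR1.
  have x0 := node_gt0 0 k.
  have s0 : 0 < sin (1%:R * pi / k.+1%:R : R).
    by apply: sin_gt0_pi; rewrite x0; exact: node_lt_pi.
  have q0 := divr_gt0 s0 x0.
  apply: ge0_ler_powR => //; rewrite ?nnegrE ?(ltW q0)//.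
  by rewrite ler_pdivrMr// [leRHS]mul1r sin_le_id.
by rewrite !damp_sincpow; apply: sincpow_le => //;
  rewrite ?node_gt0 ?node_lt_pi ?ltW ?node_lt.
Qed.

Lemma Cm_ge0 m : (0 <= Cm m)%E.
Proof.
apply: integral_ge0 => u /=; rewrite in_itv/= => /andP[u0 upi].
by rewrite lee_fin; exact: Cm_fun_ge0.
Qed.

(* The factor [sin u / u] is only defined for [u <> 0], so the sum is started at
   [eps] and [cos eps <= sin eps / eps] is used to let [eps] tend to [0]. *)
Lemma damp_sum_le m k n : 0 < m -> (n <= k)%N ->
  ((\sum_(0 <= j < n) (damp m j k - damp m j.+1 k) / (j.+1%:R * pi / k.+1%:R))%:E
   <= m%:E * Cm m)%E.
Proof.
move=> m0; case: n => [_|n nk].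
  by rewrite big_geq// mule_ge0 ?lee_fin ?(ltW m0)// Cm_ge0.
pose x j : R := j%:R * pi / k.+1%:R.
pose rest := \sum_(0 <= j < n) (damp m j.+1 k - damp m j.+2 k) / x j.+2.
have main e : 0 < e -> e < x 1%N -> 0 < cos e ->
    (((cos e `^ m - damp m 1 k) / x 1%N + rest)%:E <= m%:E * Cm m)%E.
  move=> e0 ex ce.
  (* Only node 0 moves, to [e]; the first difference then starts from [sincpow m e >= cos e ^ m]. *)
  pose y j := if j == 0%N then e else x j.
  have x1pi : x 1%N < pi by apply: node_lt_pi; exact: leq_trans nk.
  have := @sincpow_sum_le m y n.+1 (ltW m0) e0 (node_lt_pi _ _ nk).
  have yincr j : (j < n.+1)%N -> y j < y j.+1.
    by case: j => [|j] _ //; exact: node_lt.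
  move=> /(_ yincr); rewrite big_nat_recl//= => H.
  apply: le_trans (le_trans H _).
    rewrite lee_fin lerD2r ler_pM2r ?invr_gt0 ?node_gt0// lerD2r.
    apply: ge0_ler_powR; rewrite ?nnegrE ?(ltW m0) ?(ltW ce)//.
      rewrite divr_ge0 ?(ltW e0)// sin_ge0_pi// (ltW e0).
      exact: ltW (lt_trans ex x1pi).
    rewrite ler_pdivlMr// mulrC mul_cos_le_sin ?(ltW e0)//.
    exact: ltW (lt_trans ex x1pi).
  have mpi : measurable (`[0, pi]%classic : set R) by [].
  (* The integrand is nonnegative on [[0, pi]], so extending the interval cannot decrease the
     integral. *)
  rewrite [leRHS](_ : _ = \int[mu]_(u in `[0%R, pi]%classic) (m * Cm_fun m u)%:E)%E.
    apply: ge0_subset_integral => //.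
    - exact: measurable_mCm_fun.
    - move=> u /=; rewrite in_itv/= => /andP[u0 upi].
      by rewrite lee_fin mulr_ge0 ?Cm_fun_ge0// ltW.
    - move=> u /=; rewrite !in_itv/= => /andP[eu uy].
      by rewrite (le_trans (ltW e0) eu) (le_trans uy)// ltW ?node_lt_pi.
  under [RHS]eq_integral do rewrite EFinM.
  rewrite ge0_integralZl_EFin ?(ltW m0)//.
  - move=> u /=; rewrite in_itv/= => /andP[u0 upi].
    by rewrite lee_fin Cm_fun_ge0.
  - by apply/measurable_EFinP; exact: measurable_Cm_fun.
rewrite big_nat_recl//=.
(* An infinite [Cm m] makes the bound trivial; otherwise the limit is taken among reals. *)
have := Cm_ge0 m; case: (Cm m) main => [c main _| _ _|//]; last first.
  by rewrite gt0_muley ?lte_fin// leey.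
rewrite -EFinM lee_fin.
have x0 : 0 < x 1%N := node_gt0 0 k.
have pih0 : 0 < pi / 2 :> R by rewrite divr_gt0 ?pi_gt0.
(* At [e = 0] this is the required sum, since [cos 0 = 1] and [damp m 0 k = 1]. *)
pose f e := (cos e `^ m - damp m 1 k) / x 1%N + rest.
have cf : {for (0 : R), continuous f}.
  have cst (z : R) : {for (0 : R), continuous (fun=> z)} by exact: cst_continuous.
  apply: continuousD; last exact: cst.
  apply: continuousM; last exact: cst.
  apply: continuousB; last exact: cst.
  apply: (@continuous_comp _ _ _ (@cos R) (fun y : R => y `^ m)).
    exact: continuous_cos.
  apply/differentiable_continuous/derivable1_diffP.
  by apply: ex_derive; apply: is_derive1_powR; rewrite cos0.
rewrite (_ : _ + _ = f 0); last by rewrite /f cos0 powR1.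
have {}cf := cvg_at_right_filter cf.
apply: (cvgr_to_le cf); near=> e.
rewrite -lee_fin EFinM; apply: main.
- by near: e; exact: nbhs_right_gt.
- by near: e; exact: nbhs_right_lt.
- have e0 : 0 < e by near: e; exact: nbhs_right_gt.
  have e1 : e < pi / 2 by near: e; exact: nbhs_right_lt.
  by apply: cos_gt0_pihalf; rewrite e1 andbT (lt_trans _ e0)// oppr_lt0.
Unshelve. all: by end_near. Qed.

End DampingSum.

(** * Assembly of the bound *)

Theorem theorem3p3 (R : realType) (a b : R) (m : R) (k k' : nat) (theta : R) :
  -1 <= a -> a < b -> b <= 1 -> 0 < m ->
  (1 <= k)%N -> (1 <= k')%N -> (k' <= k)%N ->
  0 <= theta -> theta <= pi ->
  let alpha := acos a in
  let beta := acos b in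
  ((`|gstep alpha beta theta - gdamped alpha beta m k' k theta|)%:E
   <= (damp m k' k / (pi * k'.+1%:R))%:E * Jfun alpha beta theta
      + (m / k.+1%:R)%:E * Cm m * Jfun alpha beta theta
      + (m * pi * (pi - theta) / (3 * (k.+1%:R) ^+ 2))%:E)%E.
Proof.
move=> a1 ab b1 m0 _ _ k'k t0 tpi; cbv zeta.
set alpha := acos a; set beta := acos b.
have p0 := pi_gt0 R.
have aI : -1 <= a <= 1 by rewrite a1 (le_trans (ltW ab)).
have bI : -1 <= b <= 1 by rewrite b1 (le_trans a1)// ltW.
have beta0 : 0 <= beta := acos_ge0 bI.
have alphapi : alpha <= pi := acos_lepi aI.
have ba : beta < alpha.
  have /(_ beta alpha) := @ltr_cos R.
  rewrite !in_itv/= beta0 alphapi acos_ge0// acos_lepi// => /(_ isT isT) <-.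
  by rewrite !acosK ?in_itv.
have d0 := damp_gt0 m k' k k'k.
have k0 : 0 < k.+1%:R :> R by [].
have last0 : 0 <= m * pi * (pi - theta) / (3 * k.+1%:R ^+ 2).
  have m0' := ltW m0; have p0' := ltW p0.
  by rewrite divr_ge0 ?mulr_ge0 ?subr_ge0 ?exprn_ge0.
have mk0 : 0 < m / k.+1%:R by rewrite divr_gt0.
have pk0 : 0 < pi * k'.+1%:R :> R by rewrite mulr_gt0.
have C0 : (0 <= (m / k.+1%:R)%:E * Cm m)%E.
  by apply: mule_ge0; [rewrite lee_fin ltW|exact: Cm_ge0].
have [->|[-> ta tb]] := Jfun_Jreal _ _ _ beta0 ba alphapi t0 tpi.
  (* Here the right-hand side is infinite: [Jfun] has a positive coefficient in the first term, and
     the other terms are nonnegative. *)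
  rewrite gt0_muley ?lte_fin ?divr_gt0//.
  have Coo : (0 <= (m / k.+1%:R)%:E * Cm m * +oo)%E by exact: mule_ge0.
  by rewrite addye ?addye ?leey// gt_eqF// (lt_le_trans _ Coo)// ltNyr.
rewrite -[leLHS]adde0; apply: leeD; last by rewrite lee_fin.
set J := Jreal alpha beta theta.
have J0 : 0 <= J by rewrite /J /Jreal !addr_ge0 ?invr_ge0.
have := @damped_sum_bound R (fun j => ccoef alpha beta j * cos (j%:R * theta))
  (fun j => damp m j k) (J / pi) (gstep alpha beta theta) k' erefl
  (fun j jk => damp_decr m j k (ltW m0) (leq_trans jk k'k)) (ltW d0)
  (fun j _ => gstep_fourier_bound alpha beta theta j beta0 ba alphapi t0 tpi ta tb).
rewrite -lee_fin.
rewrite (_ : \sum_(0 <= j < k'.+1) _ = gdamped alpha beta m k' k theta); last first.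
  by apply: eq_bigr => j _; ring.
move=> /le_trans; apply; rewrite EFinD; apply: leeD.
  have -> : damp m k' k * (J / pi / k'.+1%:R) = damp m k' k / (pi * k'.+1%:R) * J.
    by rewrite invfM; ring.
  by rewrite EFinM.
set S := \sum_(0 <= j < k') _.
pose T := \sum_(0 <= j < k') (damp m j k - damp m j.+1 k) / (j.+1%:R * pi / k.+1%:R).
(* The [pi] in each node of [T] accounts for the one in [J / pi], and [k + 1] for the prefactor. *)
have -> : S * (J / pi) = (k.+1%:R)^-1 * T * J.
  rewrite /S /T mulr_suml mulr_sumr mulr_suml; apply: eq_bigr => j _.
  rewrite !invfM invrK -[LHS]mul1r -[X in X * _ = _](mulVf (lt0r_neq0 k0)).
  by ring.
rewrite EFinM lee_wpmul2r ?lee_fin//.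
rewrite [(m / _)%R]mulrC EFinM [in leRHS]EFinM -muleA lee_wpmul2l ?lee_fin//.
exact: damp_sum_le.
Qed.
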